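(* Let $a:\mathbb{N}\times\mathbb{N}\to\mathbb{C}$ be an arithmetic function of two variables. If the series $$A(n_1,n_2):=n_1n_2\sum_{k_1,k_2=1}^\infty\mu(k_1)\mu(k_2)\,a(k_1n_1,k_2n_2)$$ converges for every $n_1,n_2\in\mathbb{N}$, then for $f(n_1,n_2)=\sum_{d_1\mid n_1,\,d_2\mid n_2}A(d_1,d_2)$ we have, for all $n_1,n_2\in\mathbb{N}$, $$f(n_1,n_2)=\sum_{q_1,q_2=1}^\infty a(q_1,q_2)\,c_{q_1}(n_1)\,c_{q_2}(n_2).$$
   Context: $\mathbb{N}=\{1,2,\dots\}$. $c_q(n)=\sum_{1\le k\le q,\,(k,q)=1}\exp(2\pi i kn/q)$ is the Ramanujan sum; $\mu$ is the Möbius function. Double series $\sum_{k_1,k_2=1}^\infty$ are understood as limits of the partial sums over $k_1\le x$, $k_2\le y$ as $x,y\to\infty$. *)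

(* Defs.v *)
From HB Require Import structures.
From mathcomp Require Import all_boot all_order all_algebra.
From mathcomp Require Import all_classical all_reals all_analysis.
From mathcomp Require Import complex.

Set Implicit Arguments.
Unset Strict Implicit.
Unset Printing Implicit Defensive.

Import Order.TTheory GRing.Theory Num.Theory.
Import numFieldNormedType.Exports.

Local Open Scope classical_set_scope.
Local Open Scope ring_scope.
Local Open Scope complex_scope.

(* The normed topology on the complex numbers is carried by the regular
   algebra (R[i])^o: the instances for a numFieldType are not found on the bare
   type R[i]. *)
Notation Cplx R := ((R[i])^o) (only parsing).

Definition mobius (n : nat) : int :=
  if (0 < n)%N && all (fun p => logn p n == 1%N) (primes n)
  then (-1) ^+ size (primes n) else 0.

(* exp(i t) for a real t *)
Definition expi (R : realType) (t : R) : R[i] := cos t +i* sin t.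

Definition ramanujan_sum (R : realType) (q n : nat) : Cplx R :=
  \sum_(1 <= k < q.+1 | coprime k q)
    expi (2 * pi * k%:R * n%:R / q%:R : R).

Section DoubleSeries.
Variable R : realType.
Implicit Type u : nat -> nat -> Cplx R.

Definition dpartial u (xy : nat * nat) : Cplx R :=
  \sum_(1 <= k1 < xy.1.+1) \sum_(1 <= k2 < xy.2.+1) u k1 k2.

(* Convergence in the sense of Pringsheim: x and y tend to infinity
   independently. *)
Definition dseries_to u (l : Cplx R) : Prop :=
  dpartial u @ filter_prod \oo \oo --> l.

Definition dseries_cvg u : Prop := exists l, dseries_to u l.

Definition dseries u : Cplx R := lim (dpartial u @ filter_prod \oo \oo).

End DoubleSeries.

Section Transform.
Variable R : realType.
Variable a : nat -> nat -> Cplx R.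

Definition Aterm (n1 n2 k1 k2 : nat) : Cplx R :=
  (mobius k1)%:~R * (mobius k2)%:~R * a (k1 * n1) (k2 * n2).

Definition Acoef (n1 n2 : nat) : Cplx R :=
  n1%:R * n2%:R * dseries (Aterm n1 n2).

Definition fsum (n1 n2 : nat) : Cplx R :=
  \sum_(d1 <- divisors n1) \sum_(d2 <- divisors n2) Acoef d1 d2.

End Transform.

(* Main.v *)
Require Import Defs.
From mathcomp Require Import all_boot all_order all_algebra.
From mathcomp Require Import all_classical all_reals all_analysis.
From mathcomp Require Import complex ring lra.

Set Implicit Arguments.
Unset Strict Implicit.
Unset Printing Implicit Defensive.

Import Order.TTheory GRing.Theory Num.Theory.
Import numFieldNormedType.Exports.

Local Open Scope ring_scope.

(** Kluyver's formula [c_q(n) = \sum_(d %| gcd(q, n)) d mu(q / d)] turns every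
    rectangular partial sum of the Ramanujan series into the finite sum, over
    [d1 %| n1] and [d2 %| n2], of [d1 d2] times the partial sum up to
    [(x %/ d1, y %/ d2)] of the series defining [A(d1, d2)].  Since [x %/ d1] and
    [y %/ d2] tend to infinity with [x] and [y], each of these finitely many terms
    converges, in the sense of Pringsheim, to [A(d1, d2)]. *)

(** * Sums over multiples and divisors *)

Lemma big_multiples (V : nmodType) (F : nat -> V) (d N : nat) : (0 < d)%N ->
  \sum_(1 <= k < N.+1 | (d %| k)%N) F k = \sum_(1 <= j < (N %/ d).+1) F (j * d)%N.
Proof.
move=> d0; elim: N => [|N IH]; first by rewrite div0n !big_geq.
rewrite big_mkcond big_nat_recr //= -big_mkcond IH divnS //.
case: ifPn => [dN|_]; last by rewrite addr0.
rewrite add1n [RHS]big_nat_recr //=; congr (_ + F _).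
by rewrite -[in LHS](divnK dN) divnS // dN.
Qed.

(** The map [d] to [q %/ d] is an involution of the divisors of [q], hence permutes them. *)
Lemma big_divisors_compl (V : nmodType) (F : nat -> V) (q : nat) : (0 < q)%N ->
  \sum_(d <- divisors q) F d = \sum_(d <- divisors q) F (q %/ d)%N.
Proof.
move=> q0; rewrite -[RHS](big_map (fun d => q %/ d)%N xpredT F).
have invol d : (d %| q)%N -> (q %/ (q %/ d) = d)%N.
  by move=> dq; rewrite divnA // mulKn.
apply: perm_big; apply: uniq_perm.
- exact: divisors_uniq.
- rewrite map_inj_in_uniq ?divisors_uniq // => d e.
  rewrite -!dvdn_divisors // => dq eq_ /(congr1 (fun m => q %/ m)%N).
  by rewrite !invol.
move=> d; apply/idP/mapP => [|[e]]; rewrite -!dvdn_divisors //.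
  move=> dq; exists (q %/ d)%N; last by rewrite invol.
  by rewrite -dvdn_divisors // dvdn_div.
by move=> eq_ ->; rewrite dvdn_div.
Qed.

Lemma big_divisors_exchange (V : nmodType) (F : nat -> V) (m n : nat) :
  (0 < m)%N -> (0 < n)%N ->
  \sum_(d <- divisors m | (d %| n)%N) F d = \sum_(d <- divisors n | (d %| m)%N) F d.
Proof.
move=> m0 n0; rewrite -big_filter -[RHS]big_filter; apply: perm_big.
apply: uniq_perm; rewrite ?filter_uniq ?divisors_uniq // => d.
by rewrite !mem_filter -!dvdn_divisors // andbC.
Qed.

(** * The Moebius function *)

Lemma mobius_prime_dvd (p e : nat) : prime p -> (0 < e)%N -> (p %| e)%N ->
  mobius (p * e) = 0.
Proof.
move=> pp e0 pe; rewrite /mobius; case: ifP => // /andP[_ /allP /(_ p)].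
have p0 := prime_gt0 pp.
rewrite mem_primes pp muln_gt0 p0 e0 dvdn_mulr // => /(_ isT).
rewrite lognM // logn_prime // eqxx add1n eqSS => /eqP l0.
by move: pe; rewrite -[p]expn1 pfactor_dvdn // l0.
Qed.

(** Multiplying by [p] adds one prime, of valuation exactly 1, and keeps the other valuations: the
    squarefree test has the same outcome and the sign flips. *)
Lemma mobius_prime_ndvd (p e : nat) : prime p -> (0 < e)%N -> ~~ (p %| e)%N ->
  mobius (p * e) = - mobius e.
Proof.
move=> pp e0 pe; have p0 := prime_gt0 pp.
have pNe : p \notin primes e by rewrite mem_primes pp e0.
have P : perm_eq (primes (p * e)) (p :: primes e).
  apply: uniq_perm; rewrite /= ?primes_uniq ?pNe //= => r.
  by rewrite primesM // primes_prime // !inE.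
rewrite /mobius (perm_size P) (perm_all _ P) /= muln_gt0 p0 e0 /=.
rewrite lognM // logn_prime // eqxx (lognE p e) pp e0 (negPf pe) /=.
rewrite (eq_in_all (a2 := fun r => logn r e == 1%N)); last first.
  move=> r re; have rp : (r == p) = false.
    by apply: contraNF pNe => /eqP <-.
  by rewrite lognM // logn_prime // rp.
by case: ifP => _; rewrite ?oppr0 // exprS mulN1r.
Qed.

(* Pairing each divisor d prime to p := pdiv m with p * d cancels the sum. *)
Lemma sum_mobius_divisors (m : nat) : (0 < m)%N ->
  \sum_(d <- divisors m) mobius d = (m == 1)%:R.
Proof.
move=> m0; case: eqP => [->|/eqP m1]; first by rewrite big_seq1.
have m1' : (1 < m)%N by rewrite ltn_neqAle eq_sym m1.
pose p := pdiv m; have pp : prime p := pdiv_prime m1'.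
have p0 := prime_gt0 pp.
have pm : (p %| m)%N := pdiv_dvd m.
have mp0 : (0 < m %/ p)%N by rewrite divn_gt0 // dvdn_leq.
rewrite (bigID (fun d => p %| d)%N) /=.
have -> : \sum_(d <- divisors m | (p %| d)%N) mobius d =
          \sum_(e <- divisors (m %/ p)) mobius (p * e).
  rewrite -big_filter -[RHS](big_map (muln p) xpredT mobius).
  apply: perm_big; apply: uniq_perm.
  - by rewrite filter_uniq ?divisors_uniq.
  - rewrite map_inj_uniq ?divisors_uniq // => x y /eqP.
    by rewrite eqn_pmul2l // => /eqP.
  move=> d; rewrite mem_filter -dvdn_divisors //.
  apply/andP/mapP => [[/dvdnP[e ->]] em|[e]].
    by exists e; rewrite 1?mulnC // -dvdn_divisors // dvdn_divRL.
  rewrite -dvdn_divisors // dvdn_divRL // => em ->.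
  by rewrite dvdn_mulr // mulnC.
(* If [p] divides [e], then [p * e] has the square factor [p ^ 2] and contributes 0. *)
rewrite (bigID (fun d => p %| d)%N) /= big_seq_cond big1 ?add0r; last first.
  move=> e /andP[]; rewrite -dvdn_divisors // => em pe.
  by rewrite mobius_prime_dvd // (dvdn_gt0 mp0).
have -> : \sum_(e <- divisors (m %/ p) | ~~ (p %| e)%N) mobius (p * e) =
          - \sum_(e <- divisors (m %/ p) | ~~ (p %| e)%N) mobius e.
  rewrite -sumrN big_seq_cond [RHS]big_seq_cond; apply: eq_bigr => e /andP[].
  rewrite -dvdn_divisors // => em pe.
  by rewrite mobius_prime_ndvd // (dvdn_gt0 mp0).
(* The two remaining sums cancel: [m] and [m %/ p] have the same divisors prime to [p]. *)
apply/eqP; rewrite addrC subr_eq0; apply/eqP.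
rewrite -big_filter -[RHS]big_filter; apply: perm_big.
apply: uniq_perm; rewrite ?filter_uniq ?divisors_uniq // => d.
rewrite !mem_filter -!dvdn_divisors //; case pd: (p %| d)%N => //=.
by rewrite -{1}(divnK pm) Gauss_dvdl // coprime_sym prime_coprime // pd.
Qed.

(** * Ramanujan sums *)

Section RamanujanSum.
Variable R : realType.

Lemma expiD (s t : R) : expi (s + t) = expi s * expi t.
Proof. by rewrite /expi cosD sinD; simpc; rewrite (addrC (sin s * _)). Qed.

Lemma expi0 : expi (0 : R) = 1.
Proof. by rewrite /expi cos0 sin0. Qed.

Lemma expiMn (t : R) (k : nat) : expi (t *+ k) = expi t ^+ k.
Proof. by elim: k => [|k IH]; rewrite ?expi0 // mulrS exprS expiD IH. Qed.

Lemma expi2pi : expi (2 * pi : R) = 1.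
Proof. by rewrite /expi mulr_natl cos2pi sin2pi. Qed.

(** With [t = pi * r / q], the real part is [cos (2 t) = 1 - 2 sin t ^ 2], and [sin t > 0] because
    [t] lies strictly between 0 and [pi]. *)
Lemma expi_neq1 (r q : nat) : (0 < r < q)%N ->
  expi (2 * pi * r%:R / q%:R : R) != 1.
Proof.
move=> /andP[r0 rq]; have q0 : (0 < q)%N by apply: leq_ltn_trans rq.
pose t : R := pi * r%:R / q%:R.
have -> : 2 * pi * r%:R / q%:R = t *+ 2 by rewrite -[RHS]mulr_natl /t !mulrA.
apply/eqP => /(congr1 (@complex.Re R)) /=; rewrite cos_mulr2n cos2sin2 => cos1.
have /eqP : sin t ^+ 2 = 0 by lra.
rewrite sqrf_eq0; apply/negP; rewrite gt_eqF //.
apply: sin_gt0_pi; rewrite /t divr_gt0 ?mulr_gt0 ?pi_gt0 ?ltr0n //=.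
by rewrite ltr_pdivrMr ?ltr0n // ltr_pM2l ?pi_gt0 // ltr_nat.
Qed.

Lemma expi_eq1 (n q : nat) : (0 < q)%N ->
  (expi (2 * pi * n%:R / q%:R : R) == 1) = (q %| n)%N.
Proof.
move=> q0; have qn0 : q%:R != 0 :> R by rewrite pnatr_eq0 -lt0n.
have -> : 2 * pi * n%:R / q%:R =
    (2 * pi) *+ (n %/ q) + 2 * pi * (n %% q)%:R / q%:R :> R.
  rewrite {1}(divn_eq n q) natrD mulrDr mulrDl natrM mulrA mulfK //.
  by rewrite mulr_natr.
rewrite expiD expiMn expi2pi expr1n mul1r /dvdn.
have := ltn_pmod n q0; case: (n %% q)%N => [|r] rq.
  by rewrite mulr0 mul0r expi0 !eqxx.
by apply/negbTE/expi_neq1.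
Qed.

Lemma sum_expi (q n : nat) : (0 < q)%N ->
  \sum_(1 <= k < q.+1) expi (2 * pi * k%:R * n%:R / q%:R : R) =
  (if (q %| n)%N then q%:R else 0).
Proof.
move=> q0; have qn0 : q%:R != 0 :> R by rewrite pnatr_eq0 -lt0n.
set z := expi (2 * pi * n%:R / q%:R : R).
have zE k : expi (2 * pi * k%:R * n%:R / q%:R : R) = z ^+ k.
  by rewrite -expiMn; congr expi; rewrite -[RHS]mulr_natr; field.
rewrite (eq_bigr (fun k => z ^+ k)) // -(expi_eq1 n q0) -/z.
case: eqP => [->|/eqP z1].
  under eq_bigr do rewrite expr1n.
  by rewrite sumr_const_nat subSS subn0.
(* For [z != 1], factor out one [z]; the geometric sum left over vanishes since [z ^ q = 1]. *)
rewrite big_add1 /= big_mkord; under eq_bigr do rewrite exprS.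
rewrite -mulr_sumr; apply/eqP; rewrite mulf_eq0; apply/orP; right.
have /eqP : (z - 1) * \sum_(i < q) z ^+ i = 0.
  rewrite -subrX1 -expiMn -[_ *+ q]mulr_natr divfK //.
  by rewrite mulr_natr expiMn expi2pi expr1n subrr.
by rewrite mulf_eq0 subr_eq0 (negPf z1).
Qed.

(** Kluyver's formula. The indicator of [coprime k q] is the sum of [mobius d] over the common
    divisors of [k] and [q]; after exchanging the sums, each inner sum runs over all roots of unity
    of some order dividing [q]. *)
Lemma ramanujan_sumE (q n : nat) : (0 < q)%N -> (0 < n)%N ->
  ramanujan_sum R q n =
  \sum_(d <- divisors n | (d %| q)%N) d%:R * (mobius (q %/ d))%:~R.
Proof.
move=> q0 n0; rewrite /ramanujan_sum big_mkcond /=.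
pose E k : R[i] := expi (2 * pi * k%:R * n%:R / q%:R : R).
transitivity (\sum_(1 <= k < q.+1)
    \sum_(d <- divisors q | (d %| k)%N) (mobius d)%:~R * E k).
  apply: eq_big_nat => k /andP[k0 _].
  rewrite -mulr_suml -rmorph_sum /=.
  have g0 : (0 < gcdn k q)%N by rewrite gcdn_gt0 k0.
  have -> : \sum_(d <- divisors q | (d %| k)%N) mobius d =
            \sum_(d <- divisors (gcdn k q)) mobius d.
    rewrite -big_filter; apply: perm_big; apply: uniq_perm.
    - by rewrite filter_uniq ?divisors_uniq.
    - exact: divisors_uniq.
    by move=> d; rewrite mem_filter -!dvdn_divisors // dvdn_gcd.
  rewrite sum_mobius_divisors // -/(coprime k q).
  by case: coprime; rewrite ?mul1r ?mul0r.
(* Replacing [d] by [q %/ d] leaves the multiples [k = j * (q %/ d)] with [j] from 1 to [d], so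
   [sum_expi] applies with modulus [d]. *)
rewrite (exchange_big_dep xpredT) //= big_divisors_compl //.
rewrite -(big_divisors_exchange _ q0 n0) [RHS]big_mkcond /=.
rewrite big_seq [RHS]big_seq; apply: eq_bigr => d.
rewrite -dvdn_divisors // => dq.
have d0 : (0 < d)%N := dvdn_gt0 q0 dq.
have e0 : (0 < q %/ d)%N by rewrite divn_gt0 // dvdn_leq.
rewrite -mulr_sumr big_multiples // divnA // mulKn //.
have -> : \sum_(1 <= j < d.+1) E (j * (q %/ d))%N =
    \sum_(1 <= j < d.+1) expi (2 * pi * j%:R * n%:R / d%:R : R).
  apply: eq_bigr => j _; rewrite /E; congr expi.
  have en0 : (q %/ d)%:R != 0 :> R by rewrite pnatr_eq0 -lt0n.
  have dn0 : d%:R != 0 :> R by rewrite pnatr_eq0 -lt0n.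
  by rewrite -[in LHS](divnK dq) mulnK // !natrM; field; rewrite en0 dn0.
by rewrite sum_expi //; case: ifP; rewrite ?mulr0 // mulrC.
Qed.

(** One-variable form of the rearrangement: insert Kluyver's formula, exchange the finite sums, and
    write [q = k * d]. The weight [F] is arbitrary so that the lemma can be applied to each variable
    in turn. *)
Lemma sum_ramanujan (F : nat -> Cplx R) (n x : nat) : (0 < n)%N ->
  \sum_(1 <= q < x.+1) F q * ramanujan_sum R q n =
  \sum_(d <- divisors n)
     d%:R * \sum_(1 <= k < (x %/ d).+1) (mobius k)%:~R * F (k * d)%N.
Proof.
move=> n0; transitivity (\sum_(1 <= q < x.+1)
    \sum_(d <- divisors n | (d %| q)%N) d%:R * ((mobius (q %/ d))%:~R * F q)).
  apply: eq_big_nat => q /andP[q0 _].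
  rewrite ramanujan_sumE // mulr_sumr; apply: eq_bigr => d _.
  by rewrite mulrC -mulrA.
rewrite (exchange_big_dep xpredT) //= big_seq [RHS]big_seq.
apply: eq_bigr => d; rewrite -dvdn_divisors // => dn.
have d0 := dvdn_gt0 n0 dn.
rewrite -mulr_sumr big_multiples //; congr (_ * _).
by apply: eq_bigr => k _; rewrite mulnK.
Qed.

Lemma dpartial_ramanujan (a : nat -> nat -> Cplx R) (n1 n2 : nat) (xy : nat * nat) :
  (0 < n1)%N -> (0 < n2)%N ->
  dpartial
    (fun q1 q2 => a q1 q2 * ramanujan_sum R q1 n1 * ramanujan_sum R q2 n2) xy =
  \sum_(d1 <- divisors n1) \sum_(d2 <- divisors n2)
     d1%:R * d2%:R * dpartial (Aterm a d1 d2) (xy.1 %/ d1, xy.2 %/ d2)%N.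
Proof.
move=> n10 n20; rewrite /dpartial /=.
transitivity (\sum_(1 <= q1 < xy.1.+1)
    (\sum_(1 <= q2 < xy.2.+1) a q1 q2 * ramanujan_sum R q2 n2)
      * ramanujan_sum R q1 n1).
  apply: eq_bigr => q1 _; rewrite mulr_suml; apply: eq_bigr => q2 _.
  by rewrite mulrAC.
(* Here the weight of [q1] is the whole inner sum over [q2]. *)
rewrite sum_ramanujan //; apply: eq_bigr => d1 _.
under [in LHS]eq_bigr do rewrite sum_ramanujan // mulr_sumr.
rewrite exchange_big mulr_sumr; apply: eq_bigr => d2 _ /=.
rewrite -mulrA; congr (_ * _); rewrite mulr_sumr; apply: eq_bigr => k1 _.
rewrite mulrCA; congr (_ * _); rewrite mulr_sumr; apply: eq_bigr => k2 _.
by rewrite /Aterm mulrA.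
Qed.

End RamanujanSum.

Local Open Scope classical_set_scope.

(** * Passage to the limit in the sense of Pringsheim *)

Lemma cvg_divnr (d : nat) : (0 < d)%N -> (n %/ d)%N @[n --> \oo] --> \oo.
Proof.
move=> d0 P [N _ NP]; exists (N * d)%N => // n /= Nn; apply: NP => /=.
by rewrite leq_divRL.
Qed.

Lemma dseriesP (R : realType) (u : nat -> nat -> Cplx R) :
  dseries_cvg u -> dseries_to u (dseries u).
Proof.
by move=> [l ul]; rewrite /dseries_to /dseries (cvg_lim (@norm_hausdorff _ _) ul).
Qed.

(* The values of a at pairs with a zero coordinate are never used. *)
Theorem theorem4p1 (R : realType) (a : nat -> nat -> Cplx R)
    (hA : forall n1 n2 : nat, (0 < n1)%N -> (0 < n2)%N ->
       dseries_cvg (Aterm a n1 n2)) :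
  forall n1 n2 : nat, (0 < n1)%N -> (0 < n2)%N ->
    dseries_to
      (fun q1 q2 => a q1 q2 * ramanujan_sum R q1 n1 * ramanujan_sum R q2 n2)
      (fsum a n1 n2).
Proof.
move=> n1 n2 n10 n20; rewrite /dseries_to /fsum.
rewrite (funext (fun xy => dpartial_ramanujan a xy n10 n20)).
(* [big_seq] records that [d1] divides [n1], which gives the positivity that [hA] asks for. *)
rewrite (funext (fun xy => big_seq _ _ _ _)).
rewrite big_seq; apply: cvg_big => [|d1].
  exact: add_continuous.
rewrite -dvdn_divisors // => /(dvdn_gt0 n10) d10.
rewrite (funext (fun xy => big_seq _ _ _ _)).
rewrite big_seq; apply: cvg_big => [|d2].
  exact: add_continuous.
rewrite -dvdn_divisors // => /(dvdn_gt0 n20) d20.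
apply: cvgMl_tmp.
(* The rescaled bounds tend to infinity independently, so the limit of the series at [(d1, d2)] is
   unchanged. *)
apply: (cvg_comp (fun xy => (xy.1 %/ d1, xy.2 %/ d2)%N) _ _
          (dseriesP (hA _ _ d10 d20))).
apply: (cvg_pair (G := \oo) (H := \oo)).
  exact: cvg_comp cvg_fst (cvg_divnr d10).
exact: cvg_comp cvg_snd (cvg_divnr d20).
Qed.
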